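(* Let $(X,\mathcal F,P)$ be a non-atomic probability space, let $\mathcal A\subseteq\mathcal F$ be a sub-$\sigma$-algebra, and let $v_{\mathcal A}$ be the capacity induced by $\mathcal A$. The following are equivalent: 1. $\mathcal A$ is dense in $\mathcal F$; 2. $\int_X f\,dv_{\mathcal A}=\int_X f\,dP$ for every $f\in\mathcal M$; 3. $\lim_n\int_X f_n\,dv_{\mathcal A}=\int_X f\,dv_{\mathcal A}$ for every increasing sequence $\{f_n\}_n\subset\mathcal M$ converging weakly $v_{\mathcal A}$-a.e. to a function $f\in\mathcal M$; 4. $v_{\mathcal A}$ is null-additive.
   Context: $\mathcal M$ is the collection of all nonnegative $\mathcal F$-measurable functions on $X$. An atom of the probability space is a set $F\in\mathcal F$ with $P(F)>0$ such that every $G\in\mathcal F$ with $G\subseteq F$ has $P(G)=P(F)$ or $P(G)=0$; the space is non-atomic if it has no atoms. The capacity induced by $\mathcal A$ is $v_{\mathcal A}(F)=\max\{P(A): A\in\mathcal A, A\subseteq F\}$, $F\in\mathcal F$ (the maximum is attained). $\int_X f\,dv_{\mathcal A}$ is the Choquet integral $\int_0^\infty v_{\mathcal A}(\{x: f(x)\ge t\})\,dt\in[0,\infty]$; since $v_{\mathcal A}$ is convex (i.e. $v_{\mathcal A}(F)+v_{\mathcal A}(E)\le v_{\mathcal A}(F\cup E)+v_{\mathcal A}(F\cap E)$), it coincides with the concave integral $\sup\{\sum_{i=1}^N\lambda_i v_{\mathcal A}(F_i):\sum_{i=1}^N\lambda_i\mathbf 1_{F_i}\le f, F_i\in\mathcal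 F,\lambda_i\ge0, N\in\mathbb N\}$. $\int_X f\,dP$ is the Lebesgue integral. A collection $\mathcal C\subseteq\mathcal F$ is dense in $\mathcal F$ if for every $\varepsilon>0$ and $F\in\mathcal F$ there exists $C\in\mathcal C$ with $C\subseteq F$ and $P(F\setminus C)<\varepsilon$. A sequence $\{f_n\}_n$ is increasing if $f_n\le f_{n+1}$ pointwise for all $n$. $\{f_n\}_n$ converges to $f$ weakly $v_{\mathcal A}$-a.e. if $v_{\mathcal A}(\{x\in X: f_n(x)\nrightarrow f(x)\})=0$. $v_{\mathcal A}$ is null-additive if $v_{\mathcal A}(E\cup F)=v_{\mathcal A}(F)$ for every $E\in\mathcal F$ with $v_{\mathcal A}(E)=0$ and every $F\in\mathcal F$. *)

(* Defs.v *)
From HB Require Import structures.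
From mathcomp Require Import all_boot all_order all_algebra.
From mathcomp Require Import all_classical all_reals all_analysis.

Set Implicit Arguments.
Unset Strict Implicit.
Unset Printing Implicit Defensive.
Import Order.TTheory GRing.Theory Num.Theory.
Import numFieldNormedType.Exports.

Local Open Scope classical_set_scope.
Local Open Scope ring_scope.
Local Open Scope ereal_scope.

Section capacity.
Context {d : measure_display} {X : measurableType d} {R : realType}.
Implicit Types (P : probability X R) (A : set (set X)) (v : set X -> \bar R).

Definition is_atom P (F : set X) : Prop :=
  [/\ measurable F, 0 < P F &
    forall G, measurable G -> G `<=` F -> P G = P F \/ P G = 0].

Definition non_atomic P : Prop := forall F, ~ is_atom P F.

Definition sub_sigma_field A : Prop :=
  sigma_algebra [set: X] A /\ A `<=` measurable.

(* A total function on set X, used only at measurable F. The supremum is a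
   maximum when A is a sub-sigma-field: capacity_attained. *)
Definition capacity P A (F : set X) : \bar R :=
  ereal_sup (P @` [set B | A B /\ B `<=` F]).

Lemma capacity_attained P A (F : set X) : sub_sigma_field A ->
  exists B, [/\ A B, B `<=` F & P B = capacity P A F].
Proof.
move=> [[A0 _ AU] mA].
have [|u uS ucvg] := @ereal_sup_seq R (P @` [set B | A B /\ B `<=` F]).
  by apply/set0P; exists (P set0); exists set0 => /=; [split=> //; exact: sub0set|].
have /choice[B hB] n : exists B, (A B /\ B `<=` F) /\ P B = u n.
  by have [B AB <-] := uS n; exists B.
have AB : A (\bigcup_n B n) by apply: AU => n; have [[]] := hB n.
have BF : \bigcup_n B n `<=` F by apply: bigcup_sub => n _; have [[]] := hB n.
exists (\bigcup_n B n); split => //; apply/eqP; rewrite eq_le; apply/andP; split.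
  by apply: (@ereal_sup_ubound R); exists (\bigcup_n B n).
rewrite /capacity -(cvg_lim _ ucvg)//.
apply: lime_le; first exact: cvgP ucvg.
apply: nearW => n; have [[ABn _] <-] := hB n.
by rewrite le_measure ?inE; [|exact: mA|exact: mA|exact: bigcup_sup].
Qed.

Definition choquet v (f : X -> R) : \bar R :=
  \int[lebesgue_measure]_(t in `[0%R, +oo[) v [set x | (t <= f x)%R].

Definition nonneg_measurable (f : X -> R) : Prop :=
  measurable_fun [set: X] f /\ forall x, (0 <= f x)%R.

Definition dense_in P (C : set (set X)) : Prop :=
  forall (e : R) (F : set X), (0 < e)%R -> measurable F ->
    exists B, [/\ C B, B `<=` F & P (F `\` B) < e%:E].

Definition increasing_seq_fun (f_ : nat -> X -> R) : Prop :=
  forall n x, (f_ n x <= f_ n.+1 x)%R.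

Definition cvg_weakly_ae v (f_ : nat -> X -> R) (f : X -> R) : Prop :=
  v [set x | ~ (f_ n x @[n --> \oo] --> f x)] = 0.

Definition null_additive v : Prop :=
  forall E F, measurable E -> v E = 0 -> measurable F -> v (E `|` F) = v F.

End capacity.

(* Main.v *)
Require Import Defs.
From HB Require Import structures.
From mathcomp Require Import all_boot all_order all_algebra.
From mathcomp Require Import all_classical all_reals all_analysis.
From mathcomp Require Import measurable_realfun.

Set Implicit Arguments.
Unset Strict Implicit.
Unset Printing Implicit Defensive.

Import Order.TTheory GRing.Theory Num.Theory.
Import numFieldNormedType.Exports.

Local Open Scope classical_set_scope.
Local Open Scope ring_scope.
Local Open Scope ereal_scope.

(** The four conditions all say that the capacity [v] of [A] agrees with [P] on
measurable sets.

If [A] is dense, a measurable [F] is exhausted from inside by members of [A], so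
[v F = P F] ([dense_capacity]); the Choquet integral of [f] is then
[\int_0^oo P (f >= t) dt], which is the Lebesgue integral of [f]
([layer_cake]). Conversely, equality of the two integrals on indicator
functions gives [v = P] ([choquet_indic]), so that weak [v]-a.e. convergence is
[P]-a.e. convergence and the third condition is the monotone convergence theorem
([increasing_ae_cvg_integral]). When [v E = 0], the constant sequence [\1_F]
converges weakly [v]-a.e. to [\1_(E `|` F)], as it can fail to converge only on
a subset of [E]; comparing Choquet integrals gives null-additivity.

The remaining implication is [null_additive_dense]. Let [B] be a member of [A]
of maximal probability inside [F], and [G = F `\` B], so that [v G = 0].
Null-additivity applied to [G] and its complement gives [v (~` G) = v setT = 1].
The complement of [G] thus contains a member of [A] of full probability, hence
[P G = 0]: [B] already fills [F] up to a [P]-null set. *)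

(** Tonelli for the region between the graph of [f] and zero: its horizontal
sections are the upper level sets of [f], its vertical ones the intervals
[[0, f x]]. *)
Lemma layer_cake (d : measure_display) (X : measurableType d) (R : realType)
    (mu : {sigma_finite_measure set X -> \bar R}) (f : X -> R) :
  nonneg_measurable f -> choquet mu f = \int[mu]_x (f x)%:E.
Proof.
move=> [mf f0].
pose leb := @lebesgue_measure R.
pose E : set (X * measurableTypeR R) :=
  [set z | (0 <= z.2)%R && (z.2 <= f z.1)%R].
have mE : measurable E.
  rewrite (_ : E = (setT `&` [set z | (0 <= z.2)%R]) `&`
                   (setT `&` [set z | (z.2 <= f z.1)%R])); last first.
    apply/seteqP; split=> z; rewrite /E /=; last by move=> [[_ ->] [_ ->]].
    by move=> /andP[-> ->].
  apply: measurableI; apply: measurable_fun_le => //.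
  by apply: measurableT_comp mf _.
have := @indic_fubini_tonelli _ _ _ _ R mu leb E mE.
rewrite indic_fubini_tonelli_FE// indic_fubini_tonelli_GE// => hE.
transitivity (\int[leb]_t (mu \o ysection E) t).
  rewrite /choquet integral_mkcond; apply: eq_integral => t _.
  rewrite patchE /=; case: ifPn => [|].
    rewrite inE /= in_itv /= andbT => t0; congr (mu _).
    by apply/seteqP; split=> x; rewrite /ysection /= inE /E /= t0.
  rewrite notin_setE /= in_itv /= andbT => /negP t0.
  rewrite (_ : ysection E t = set0) ?measure0//.
  by apply/seteqP; split=> x //; rewrite /ysection /= inE /E /= (negbTE t0).
rewrite -hE; apply: eq_integral => x _ /=.
rewrite (_ : xsection E x = `[0%R, f x]%classic); last first.
  by apply/seteqP; split=> t; rewrite /xsection /= inE /E /= in_itv.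
rewrite /leb lebesgue_measure_itv /= lte_fin sube0.
by case: ltgtP (f0 x) => // <-.
Qed.

(** The upper level set of [\1_F] at [t] is [F] for [0 < t <= 1] and empty for
[1 < t]. At [t = 0] it is the whole space, whose value under [v] is arbitrary,
but a single [t] does not affect the integral. *)
Lemma choquet_indic (d : measure_display) (X : measurableType d) (R : realType)
    (v : set X -> \bar R) (F : set X) :
  v set0 = 0 -> choquet v \1_F = v F.
Proof.
move=> v0.
pose D : set R := `]0%R, +oo[%classic.
pose I : set R := `]0%R, 1%R]%classic.
pose h : R -> \bar R := cst (v F) \_ I.
have mI : measurable I by exact: measurable_itv.
have ID : I `<=` D by move=> t; rewrite /I /D /= !in_itv /= => /andP[->].
have vE : {in D, h =1 fun t : R => v [set x | (t <= \1_F x)%R]}.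
  move=> t; rewrite inE /D /= in_itv /= andbT => t0.
  rewrite /h patchE; case: ifPn => [|].
    rewrite inE /I /= in_itv /= => /andP[_ t1]; congr v.
    apply/seteqP; split=> x /=; rewrite indicE; first by move/mem_set ->.
    by case: (boolP (x \in F)) => [/set_mem//|_]; rewrite leNgt t0.
  rewrite notin_setE /I /= in_itv /= t0 /= => /negP; rewrite -ltNge => t1.
  rewrite (_ : [set x | _] = set0) ?v0//.
  apply/seteqP; split=> x //=; rewrite leNgt indicE.
  by case: (x \in F); rewrite ?t1 ?t0.
have mh : measurable_fun D h.
  apply: measurable_funTS.
  by have [+ _] := measurable_restrictT (cst (v F)) mI; apply.
rewrite /choquet -integral_itv_obnd_cbnd; last exact: eq_measurable_fun vE mh.
transitivity (\int[lebesgue_measure]_(t in D) h t).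
  by apply: eq_integral => t /vE ->.
rewrite /h -integral_mkcondr (setIidr ID) integral_cst//=.
have -> : lebesgue_measure I = 1.
  by rewrite lebesgue_measure_itv /= lte_fin ltr01 sube0.
by rewrite mule1.
Qed.

Lemma nonneg_measurable_indic (d : measure_display) (X : measurableType d)
    (R : realType) (F : set X) :
  measurable F -> nonneg_measurable (\1_F : X -> R).
Proof. by move=> mF; split=> [|x]; [exact: measurable_indic|rewrite indicE]. Qed.

Section capacity_theory.
Context (d : measure_display) (X : measurableType d) (R : realType).
Context (P : probability X R) (A : set (set X)).
Hypothesis A_sub : sub_sigma_field A.

Let mA B : A B -> measurable B. Proof. by case: A_sub => _; exact. Qed.

Lemma capacity_ge B F : A B -> B `<=` F -> P B <= capacity P A F.
Proof. by move=> AB BF; apply: (@ereal_sup_ubound R); exists B. Qed.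

Lemma capacity_le F : measurable F -> capacity P A F <= P F.
Proof.
move=> mF; have [B [AB BF <-]] := @capacity_attained _ _ _ P A F A_sub.
by apply: le_measure; rewrite ?inE//; exact: mA.
Qed.

Lemma capacity0 : capacity P A set0 = 0.
Proof.
have [B [_ B0 <-]] := @capacity_attained _ _ _ P A set0 A_sub.
by move: B0; rewrite subset0 => ->; exact: measure0.
Qed.

Lemma le_capacity F G : F `<=` G -> capacity P A F <= capacity P A G.
Proof.
move=> FG; have [B [AB BF <-]] := @capacity_attained _ _ _ P A F A_sub.
exact: capacity_ge AB (subset_trans BF FG).
Qed.

Lemma dense_capacity : dense_in P A ->
  forall F, measurable F -> capacity P A F = P F.
Proof.
move=> dA F mF; apply/eqP; rewrite eq_le capacity_le//=.
apply/lee_addgt0Pr => e e0; have [B [AB BF PFB]] := dA e F e0 mF.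
have mB := mA AB.
rewrite -(setDUK BF) measureU//; [|exact: measurableD|exact: setDIK].
by apply: leeD; [exact: capacity_ge|exact: ltW].
Qed.

(** Take for [B] a member of [A] attaining the capacity of [F]: a member of [A]
of positive probability in [F `\` B] could be added to [B]. *)
Lemma capacity_setD_max F : exists B,
  [/\ A B, B `<=` F & capacity P A (F `\` B) = 0].
Proof.
have [B [AB BF PB]] := @capacity_attained _ _ _ P A F A_sub.
exists B; split=> //.
have [C [AC CFB <-]] := @capacity_attained _ _ _ P A (F `\` B) A_sub.
have ABC : A (B `|` C).
  have [[A0 _ AU] _] := A_sub.
  by rewrite -bigcup2E; apply: AU => -[|[|n]].
have BC0 : B `&` C = set0 by rewrite setIC; apply/disjoints_subset => x /CFB[].
have BCF : B `|` C `<=` F by rewrite subUset; split => // x /CFB[].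
have := capacity_ge ABC BCF.
rewrite measureU; [|exact: mA|exact: mA|exact: BC0].
rewrite -PB -[leRHS]adde0 leeD2lE ?fin_num_measure//; last exact: mA.
by rewrite measure_le0 => /eqP.
Qed.

(** Null-additivity forbids the difference [G] between [F] and its best
approximation from inside to have positive probability: [G] is [v]-null, so its
complement keeps the capacity of the whole space. *)
Lemma null_additive_dense : null_additive (capacity P A) -> dense_in P A.
Proof.
move=> nA e F e0 mF; have [B [AB BF vG]] := capacity_setD_max F.
exists B; split=> //.
have mG : measurable (F `\` B) by apply: measurableD => //; exact: mA.
have [C [AC CG PC]] := @capacity_attained _ _ _ P A (~` (F `\` B)) A_sub.
have {}PC : P C = 1.
  rewrite PC -(nA _ _ mG vG); last exact: measurableC.
  rewrite setUv; apply/eqP; rewrite eq_le -(probability_setT P) capacity_le//=.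
  have [[A0 AD _] _] := A_sub.
  by apply: capacity_ge => //; rewrite -(setD0 setT); exact: AD.
have PG : P (F `\` B) <= P (~` C).
  apply: le_measure; rewrite ?inE//; first by apply: measurableC; exact: mA.
  by move=> x Gx /CG.
apply: le_lt_trans PG _; rewrite probability_setC; last exact: mA.
by rewrite PC subee.
Qed.
End capacity_theory.

Section increasing_limit.
Context (d : measure_display) (X : measurableType d) (R : realType).
Context (f_ : nat -> X -> R) (f : X -> R).
Hypothesis mf_ : forall n, nonneg_measurable (f_ n).
Hypothesis mf : nonneg_measurable f.
Hypothesis f_nd : increasing_seq_fun f_.

Let g n x := (f_ n x)%:E.
Let l x := limn (g ^~ x).

Let mg n : measurable_fun setT (g n).
Proof. by apply/measurable_EFinP; case: (mf_ n). Qed.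

Let g0 n x : 0 <= g n x. Proof. by rewrite lee_fin; case: (mf_ n). Qed.

Let g_nd x : nondecreasing_seq (g ^~ x).
Proof. by apply/nondecreasing_seqP => n; rewrite lee_fin; exact: f_nd. Qed.

Let cvg_g x : g n x @[n --> \oo] --> l x.
Proof. exact: ereal_nondecreasing_is_cvgn (g_nd x). Qed.

Let ml : measurable_fun setT l.
Proof. by apply: emeasurable_fun_cvg mg _ => x _; exact: cvg_g. Qed.

Let mfE : measurable_fun setT (EFin \o f).
Proof. by apply/measurable_EFinP; case: mf. Qed.

(** The limit [l] exists everywhere in the extended reals by monotonicity, so
real convergence to [f] is an equality between two measurable functions. *)
Let lE x : l x = (f x)%:E <-> f_ n x @[n --> \oo] --> f x.
Proof.
split=> [lf|ff]; last by apply: cvg_lim => //; exact: cvg_comp ff _.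
by have := @cvg_g x; rewrite lf => /fine_cvgP[].
Qed.

Lemma measurable_increasing_ncvg :
  measurable [set x | ~ (f_ n x @[n --> \oo] --> f x)].
Proof.
rewrite (_ : [set x | _] = setT `&` [set x | l x != (EFin \o f) x]).
  exact: measurable_neqe.
by rewrite setTI; apply/seteqP; split=> x /=; rewrite -lE => /eqP.
Qed.

(** Monotone convergence gives the integral of the pointwise limit [l], which
coincides with [f] off the null set where convergence fails. *)
Lemma increasing_ae_cvg_integral (mu : {measure set X -> \bar R}) :
  cvg_weakly_ae mu f_ f ->
  \int[mu]_x (f_ n x)%:E @[n --> \oo] --> \int[mu]_x (f x)%:E.
Proof.
move=> f_cvg; have -> : \int[mu]_x (f x)%:E = \int[mu]_x l x.
  apply/esym/ge0_ae_eq_integral => //.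
  - move=> x _; apply: lime_ge; first exact: cvgP (@cvg_g x).
    by apply: nearW => n; exact: g0.
  - by move=> x _; rewrite lee_fin; case: mf.
  - exists [set x | ~ (f_ n x @[n --> \oo] --> f x)]; split=> //.
      exact: measurable_increasing_ncvg.
    by move=> x /= lf fx; apply: lf => _; exact/lE.
exact: (@cvg_monotone_convergence _ _ _ mu _ measurableT g).
Qed.
End increasing_limit.

Theorem proposition1 (d : measure_display) (X : measurableType d)
    (R : realType) (P : probability X R) (A : set (set X))
    (P_non_atomic : non_atomic P) (A_sub : sub_sigma_field A) :
  [<->
    dense_in P A;
    forall f : X -> R, nonneg_measurable f ->
      choquet (capacity P A) f = \int[P]_x (f x)%:E;
    forall (f_ : nat -> X -> R) (f : X -> R),
      (forall n, nonneg_measurable (f_ n)) -> nonneg_measurable f ->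
      increasing_seq_fun f_ -> cvg_weakly_ae (capacity P A) f_ f ->
      choquet (capacity P A) (f_ n) @[n --> \oo] --> choquet (capacity P A) f;
    null_additive (capacity P A)].
Proof.
tfae.
- move=> /(dense_capacity A_sub) vP f mf.
  rewrite -layer_cake//; apply: eq_integral => t _.
  apply: vP; rewrite -[X in measurable X]setTI.
  by apply: measurable_fun_le => //; case: mf.
- move=> vP f_ f mf_ mf f_nd f_cvg.
  have vPm F : measurable F -> capacity P A F = P F.
    move=> mF; rewrite -(@choquet_indic _ _ R (capacity P A)) ?capacity0//.
    by rewrite vP ?integral_indic ?setIT//; exact: nonneg_measurable_indic.
  rewrite vP//; under eq_fun do rewrite vP//.
  apply: increasing_ae_cvg_integral => //.
  move: f_cvg; rewrite /cvg_weakly_ae vPm//.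
  exact: measurable_increasing_ncvg.
- move=> mct E F mE vE mF.
  have v0 := capacity0 P A_sub.
  have : choquet (capacity P A) (\1_F : X -> R) @[n --> \oo] -->
         choquet (capacity P A) (\1_(E `|` F) : X -> R).
    apply: (mct (fun=> \1_F)); [move=> _| |by []|].
    + exact: nonneg_measurable_indic.
    + by apply: nonneg_measurable_indic; exact: measurableU.
    + apply/eqP; rewrite eq_le -[X in _ <= X]vE; apply/andP; split.
        apply: le_capacity => // x /= ncvg; apply: contrapT => Ex; apply: ncvg.
        by rewrite !indicE in_setU (memNset Ex); exact: cvg_cst.
      by rewrite -v0; exact: le_capacity.
  by rewrite !choquet_indic// => /cvg_lim <-//; rewrite lim_cst.
- exact: null_additive_dense.
Qed.
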